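(* Let $G$ be a finite simple graph with $n$ vertices and a fixed total order on $E(G)$, and let $x$ be a positive integer. Let $S$ be the set of pairs $(F,c)$ where $F$ is an internal spanning forest of $G$ and $c:V(G)\to\{1,\dots,x\}$ is a proper colouring of $F$. Then \[\tau_G(x)=(-1)^n\sum_{(F,c)\in S}(-1)^{|C(F)|},\] where $|C(F)|$ is the number of connected components of $F$.
   Context: A broken circuit is the edge set of a cycle of $G$ with its smallest edge removed; $B_G$ is the set of all $S\subseteq E(G)$ containing no broken circuit. A spanning forest $F$ of $G$ is internal if $E(F)\in B_G$ (equivalently, no edge $e\notin E(F)$ closes a cycle in $F\cup e$ in which $e$ is the minimal edge). $X_G=\sum_\kappa\prod_v x_{\kappa(v)}$ over proper colourings $\kappa:V(G)\to\{1,2,\dots\}$; $P_\lambda$ is the disjoint union of paths with $\lambda_1,\dots,\lambda_{\ell(\lambda)}$ vertices; $\{X_{P_\lambda}\}$ is a basis of the symmetric functions over $\mathbb{Q}$; and $\tau_G(x)=\sum_\lambda a_\lambda x^{\ell(\lambda)}$ where $X_G=\sum_\lambda a_\lambda X_{P_\lambda}$. *)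

(* Defs.v *)
From HB Require Import structures.
From mathcomp Require Import all_boot all_order all_algebra.
From mathcomp Require Import mpoly.
Set Implicit Arguments. Unset Strict Implicit. Unset Printing Implicit Defensive.
Import Order.TTheory GRing.Theory Num.Theory.

Section Graphs.
Variables (V : finType) (g : rel V).

Definition edges : {set {set V}} := [set [set p.1; p.2] | p in [set p : V * V | g p.1 p.2]].

Definition is_cycle_seq (s : seq V) : bool := (2 < size s) && uniq s && cycle g s.

Definition cycle_edges (s : seq V) : {set {set V}} := [set [set x; next s x] | x in s].

(* F contains the edge set of some cycle (cycles have at most #|V| vertices) *)
Definition has_cycle (F : {set {set V}}) : bool :=
  [exists k : 'I_(#|V|).+1, exists t : k.-tuple V,
     is_cycle_seq t && (cycle_edges t \subset F)].

Definition spanning_forest (F : {set {set V}}) : bool :=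
  (F \subset edges) && ~~ has_cycle F.

Definition no_broken_circuit (w : {set V} -> nat) (F : {set {set V}}) : bool :=
  [forall k : 'I_(#|V|).+1, forall t : k.-tuple V,
     is_cycle_seq t ==>
     [forall e0 in cycle_edges t,
        [forall e in cycle_edges t, w e0 <= w e] ==>
        ~~ (cycle_edges t :\ e0 \subset F)]].

Definition internal_forest (w : {set V} -> nat) (F : {set {set V}}) : bool :=
  spanning_forest F && no_broken_circuit w F.

Definition ncomp (F : {set {set V}}) : nat :=
  n_comp (fun u v => [set u; v] \in F) [set: V].

Definition proper_on (F : {set {set V}}) (x : nat) (c : {ffun V -> 'I_x}) : bool :=
  [forall u, forall v, ([set u; v] \in F) ==> (c u != c v)].

(* chromatic symmetric function, restricted to N variables x_0..x_{N-1} *)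
Definition chrom (N : nat) : {mpoly rat[N]} :=
  \sum_(k : {ffun V -> 'I_N} | [forall u, forall v, g u v ==> (k u != k v)])
     \prod_(v : V) 'X_(k v).

End Graphs.

(* partitions of n: nonincreasing n-tuples of numbers <= n, padded with 0s *)
Definition is_partn (n : nat) (l : n.-tuple 'I_n.+1) : bool :=
  sorted geq (map val l) && (sumn (map val l) == n).

Definition parts (n : nat) (l : n.-tuple 'I_n.+1) : seq nat :=
  filter (fun k => k != 0) (map val l).

(* P_s: disjoint union of paths with s_1, s_2, ... vertices, on vertex set
   'I_(sumn s); blocks are consecutive intervals starting at prefix sums *)
Definition block_starts (s : seq nat) : seq nat :=
  [seq sumn (take k s) | k <- iota 0 (size s).+1].

Definition path_rel (s : seq nat) : rel 'I_(sumn s) :=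
  fun i j => ((val j == (val i).+1) && (val j \notin block_starts s))
          || ((val i == (val j).+1) && (val i \notin block_starts s)).

(* Main.v *)
(** Write p_k for the power sums. Whitney's theorem, obtained by toggling in an
    edge set the heaviest edge that closes one of its broken circuits, expands
    X_G as the sum over internal forests F of (-1)^|E(F)| times the product of
    p_|C| over the components C of F. For paths,
    X_(P_m) = sum_(1 <= k <= m) (-1)^(k-1) p_k X_(P_(m-k)), which can be solved
    for p_m; hence X_G lies in the span of the X_(P_l).

    For the formula, choose complex numbers z_1, ..., z_n with
    p_k(z) = x (x-1)^(k-1) for 1 <= k <= n, the number of proper x-colourings of
    a tree on k vertices. The path recursion then gives X_(P_m)(z) = x for
    1 <= m <= n, so evaluating any expansion of X_G at z yields tau_G(x), while
    Whitney's expansion at z counts proper colourings of internal forests. *)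
Require Import Defs.
From HB Require Import structures.
From mathcomp Require Import all_boot all_order all_algebra all_field.
From mathcomp Require Import mpoly ring zify.
Import Order.TTheory GRing.Theory Num.Theory.
Local Open Scope ring_scope.
Set Implicit Arguments. Unset Strict Implicit. Unset Printing Implicit Defensive.

(** Colour weights from any commutative ring: the variables give [chrom], complex numbers its
    values, and the constant 1 the number of proper colourings. *)
Definition chrom_at (R : comNzRingType) (I V : finType) (z : I -> R)
    (g : rel V) : R :=
  \sum_(k : {ffun V -> I} | [forall u, forall v, g u v ==> (k u != k v)])
     \prod_v z (k v).

Definition psum (R : comNzRingType) (I : finType) (z : I -> R) (m : nat) : R :=
  \sum_i z i ^+ m.

(** * Paths *)

Section Paths.
Variables (R : comNzRingType) (I : finType) (z : I -> R).

Local Notation p := (psum z).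

(** Weighted sum over the proper colourings of a path on [m] vertices whose first vertex is not
    coloured [a]. *)
Fixpoint path_avoiding (m : nat) (a : I) : R :=
  if m is m'.+1 then \sum_(b | b != a) z b * path_avoiding m' b else 1.

Definition path_chrom (m : nat) : R :=
  if m is m'.+1 then \sum_b z b * path_avoiding m' b else 1.

(** The first vertex of the path either avoids the colour [a] or has it; the latter case brings one
    more factor [z a]. *)
Lemma psum_mul_path_chrom r m :
  p r * path_chrom m.+1 = \sum_a z a ^+ r * path_avoiding m.+1 a
                        + \sum_a z a ^+ r.+1 * path_avoiding m a.
Proof.
rewrite mulr_suml -big_split /=; apply: eq_bigr => a _.
rewrite (bigD1 a) //= mulrDr addrC exprSr mulrA; congr (_ + _).
Qed.

(** Unroll [psum_mul_path_chrom]: the sum at [m.+1] is a product minus the same kind of sum with [r]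
    raised and [m] lowered. At [r = 0] the left side is [path_chrom m.+1]. *)
Lemma path_chrom_alternating r m :
  \sum_a z a ^+ r.+1 * path_avoiding m a =
  \sum_(j < m.+1) (-1) ^+ j * p (r.+1 + j) * path_chrom (m - j).
Proof.
elim: m r => [|m IH] r.
  rewrite big_ord1 /= expr0 mul1r mulr1 addn0.
  by apply: eq_bigr => a _; rewrite mulr1.
rewrite big_ord_recl [path_chrom _]/= addn0 expr0 mul1r psum_mul_path_chrom IH.
rewrite -addrA -[LHS]addr0; congr (_ + _).
rewrite -big_split /= big1 // => j _.
by rewrite /bump /= add1n subSS exprS addnS addSn mulN1r !mulNr addrN.
Qed.

Lemma path_chrom_rec m :
  path_chrom m.+1 =
  \sum_(j < m.+1) (-1) ^+ j * p j.+1 * path_chrom (m - j).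
Proof. exact: (path_chrom_alternating 0). Qed.

(* [b j] tells whether vertex [j] is linked to its predecessor; the predecessor
   of vertex [0] is a virtual vertex coloured [a], so that the first vertex of a
   path can be peeled off. *)
Definition link_proper (b : nat -> bool) (m : nat) (a : I)
    (k : {ffun 'I_m -> I}) : bool :=
  [forall i : 'I_m, forall j : 'I_m,
     (val j == (val i).+1) && b j ==> (k i != k j)] &&
  [forall i : 'I_m, (val i == 0%N) && b 0%N ==> (k i != a)].

Definition link_chrom (b : nat -> bool) (m : nat) (a : I) : R :=
  \sum_(k : {ffun 'I_m -> I} | link_proper b a k) \prod_i z (k i).

(** Once the first vertex has colour [c], it serves as the virtual predecessor of the remaining
    ones. *)
Lemma link_chromS b m a :
  link_chrom b m.+1 a =
  \sum_(c | b 0%N ==> (c != a)) z c * link_chrom (fun j => b j.+1) m c.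
Proof.
rewrite /link_chrom.
rewrite (partition_big (fun k : {ffun 'I_m.+1 -> I} => k ord0)
           (fun c => b 0%N ==> (c != a))) /=; last first.
  by move=> k /andP[_ /forallP/(_ ord0)].
apply: eq_bigr => c Hc; rewrite big_distrr /=.
(* [h] prepends the colour [c], and [h'] forgets the first vertex. *)
pose h (k : {ffun 'I_m -> I}) : {ffun 'I_m.+1 -> I} :=
  [ffun i => if unlift ord0 i is Some j then k j else c].
pose h' (k : {ffun 'I_m.+1 -> I}) : {ffun 'I_m -> I} :=
  [ffun i => k (lift ord0 i)].
have h0 k : h k ord0 = c by rewrite ffunE unlift_none.
have hS k i : h k (lift ord0 i) = k i by rewrite ffunE liftK.
rewrite (reindex_onto h h') /=; last first.
  move=> k /andP[_ /eqP kc]; apply/ffunP => i; rewrite !ffunE.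
  by case: unliftP => [j|] ->; rewrite ?ffunE.
apply: eq_big => [k|k _]; last first.
  by rewrite big_ord_recl h0; congr (_ * _); apply: eq_bigr => i _; rewrite hS.
rewrite h0 eqxx andbT.
have -> : h' (h k) == k by apply/eqP/ffunP => i; rewrite ffunE hS.
rewrite andbT; apply/idP/idP.
  case/andP => /'forall_forallP/= H1 H2; apply/andP; split.
    apply/'forall_forallP => i j; apply/implyP => Hij.
    by have := H1 (lift ord0 i) (lift ord0 j); rewrite !hS => /implyP; apply.
  apply/forallP => i; apply/implyP => Hi.
  case/andP: Hi => /eqP/= i0 b1; have := H1 ord0 (lift ord0 i).
  by rewrite hS h0 /= /bump i0 => /implyP/(_ b1); rewrite eq_sym.
case/andP => /'forall_forallP/= H1 /forallP/= H2; apply/andP; split.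
  apply/'forall_forallP => i j; apply/implyP => /=.
  case: (unliftP ord0 j) => [j' ->|-> //].
  case: (unliftP ord0 i) => [i' ->|->] /=; rewrite ?hS ?h0.
    rewrite /bump !add1n eqSS => Hij.
    by have := H1 i' j' => /implyP; apply.
  rewrite /bump add1n eqSS => /andP[/eqP j0]; rewrite j0 => b1.
  by have := H2 j'; rewrite j0 => /implyP/(_ b1); rewrite eq_sym.
apply/forallP => i; apply/implyP => /andP[/eqP i0 b0].
have -> : i = ord0 by apply/val_inj.
by rewrite h0; move: Hc; rewrite b0.
Qed.

Lemma link_chrom0 b a : link_chrom b 0 a = 1.
Proof.
rewrite /link_chrom (big_pred1 [ffun i => a]) ?big_ord0 // => k.
have -> : k = [ffun i => a] by apply/ffunP => - [].
by rewrite /= eqxx; apply/andP; split; apply/forallP => - [].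
Qed.

Lemma eq_link_chrom (b b' : nat -> bool) m a :
  (forall j, (j < m)%N -> b j = b' j) -> link_chrom b m a = link_chrom b' m a.
Proof.
move=> E; apply: eq_bigl => k; congr (_ && _).
  by apply: eq_forallb => i; apply: eq_forallb => j; rewrite E.
apply: eq_forallb => i; case: eqP => //= i0; rewrite E //.
exact: leq_ltn_trans (ltn_ord i).
Qed.

Lemma link_chrom_start b m a a' :
  b 0%N = false -> link_chrom b m a = link_chrom b m a'.
Proof. by case: m => [|m] b0; rewrite ?link_chrom0 // !link_chromS b0. Qed.

(** The first [q] vertices form a chain attached to the virtual predecessor, and the missing link at
    [q] separates them from the rest. *)
Lemma link_chrom_cat (b b' : nat -> bool) q m a a' :
  (forall j, (j < q)%N -> b j) -> (forall j, b (q + j)%N = b' j) ->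
  b' 0%N = false ->
  link_chrom b (q + m) a = path_avoiding q a * link_chrom b' m a'.
Proof.
elim: q b a => [|q IH] b a Hb Hb' b0.
  rewrite add0n /= mul1r (link_chrom_start m a' a) //.
  by apply: eq_link_chrom => j _; apply: Hb'.
rewrite addSn link_chromS (Hb 0%N) //= mulr_suml; apply: eq_bigr => c _.
rewrite (IH (fun j => b j.+1)) ?mulrA // => j jq; exact: Hb.
Qed.

Lemma mem_block_starts_cons q s j :
  j \in block_starts (q :: s) =
  (j == 0%N) || (q <= j)%N && (j - q \in block_starts s)%N.
Proof.
apply/mapP/orP => [[[|k]]|].
- by rewrite take0 => _ ->; left.
- rewrite mem_iota /= add0n ltnS => ks ->; right.
  rewrite leq_addr addKn; apply/mapP; exists k => //.
  by rewrite mem_iota /= add0n.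
case=> [/eqP->|/andP[qj /mapP[k ks E]]]; first by exists 0%N; rewrite ?take0.
exists k.+1; first by move: ks; rewrite !mem_iota.
by rewrite /= -E subnKC.
Qed.

(** The start of each block is unlinked, so its colour is free; [link_chrom_cat] then splits off the
    other vertices of the block. *)
Lemma link_chrom_blocks (s : seq nat) a :
  all (fun q => q != 0%N) s ->
  link_chrom (fun j => j \notin block_starts s) (sumn s) a =
  \prod_(q <- s) path_chrom q.
Proof.
have bs0 t : (0%N \in block_starts t).
  by apply/mapP; exists 0%N; rewrite ?take0 // mem_iota.
elim: s a => [|[|q] s IH] a //= Hs.
  by rewrite link_chrom0 big_nil.
rewrite big_cons link_chromS bs0 /= mulr_suml; apply: eq_bigr => c _.
rewrite -mulrA; congr (_ * _).
rewrite (@link_chrom_cat _ (fun j => j \notin block_starts s) _ _ _ c).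
- by rewrite IH.
- by move=> j jq; rewrite mem_block_starts_cons /= ltnNge -ltnS ltnS jq.
- by move=> j; rewrite mem_block_starts_cons /= ltnS leq_addr subSS addKn.
- by rewrite bs0.
Qed.

Lemma chrom_at_path (s : seq nat) :
  all (fun q => q != 0%N) s ->
  chrom_at z (@path_rel s) = \prod_(q <- s) path_chrom q.
Proof.
move=> Hs.
(* The link sums need some colour [a] for the virtual predecessor. If there is no colour at all,
   both sides are 1 for empty [s] and 0 otherwise. *)
have [a _|I0] := pickP (@predT I); last first.
  case: s Hs => [|[|q] s] //= _.
    rewrite big_nil /chrom_at.
    have fE (k k' : {ffun 'I_(sumn [::]) -> I}) : k = k'.
      by apply/ffunP => - [].
    have e : {ffun 'I_(sumn [::]) -> I} by apply: finfun => - [].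
    rewrite (big_pred1 e) => [|k]; first by rewrite big_ord0.
    by rewrite /= (fE k e) eqxx; apply/'forall_forallP => - [].
  rewrite big_cons /= [X in X * _]big_pred0 // mul0r.
  rewrite /chrom_at big1 // => k _.
  by have := I0 (k ord0).
rewrite -(link_chrom_blocks a Hs); apply: eq_bigl => k.
have bs0 t : (0%N \in block_starts t).
  by apply/mapP; exists 0%N; rewrite ?take0 // mem_iota.
have E : [forall i : 'I_(sumn s), (val i == 0%N) && ~~ true ==> (k i != a)].
  by apply/forallP => i; rewrite andbF.
rewrite /link_proper bs0 E andbT.
apply/'forall_forallP/'forall_forallP => H i j; apply/implyP => Hij.
  by have := H i j => /implyP; apply; rewrite /path_rel Hij.
case/orP: Hij => Hij; first by have := H i j => /implyP; apply.
by rewrite eq_sym; have := H j i => /implyP; apply.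
Qed.

End Paths.

(** * Subset expansions and components *)

Section Toggle.
Variables (R : comNzRingType) (T : finType).
Implicit Types (S : {set T}) (e : T).

Definition toggle e S := if e \in S then S :\ e else e |: S.

Lemma toggleK e : involutive (toggle e).
Proof.
move=> S; rewrite /toggle; case: (boolP (e \in S)) => eS; rewrite !inE eqxx /=.
  by rewrite setD1K.
by rewrite setU1K.
Qed.

Lemma in_toggle e S : (e \in toggle e S) = (e \notin S).
Proof. by rewrite /toggle; case: ifP => eS; rewrite !inE eqxx. Qed.

(** Toggling [m S] is a sign-reversing involution without fixed points. Pairing the sets that
    contain [m S] with those that do not avoids a division by 2. *)
Lemma sum_sign_toggle (P : pred {set T}) (m : {set T} -> T) :
  (forall S, P S -> P (toggle (m S) S) && (m (toggle (m S) S) == m S)) ->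
  \sum_(S | P S) (-1) ^+ #|S| = 0 :> R.
Proof.
move=> Pm; rewrite (bigID (fun S => m S \in S)) /=.
pose t S := toggle (m S) S.
rewrite (reindex_onto t t) /=; last first.
  by move=> S /andP[PS _]; case/andP: (Pm S PS) => _ /eqP E; rewrite /t E toggleK.
have E S : P (t S) && (m (t S) \in t S) && (t (t S) == S)
         = P S && (m S \notin S).
  apply/idP/idP.
    case/andP => /andP[PU mU] /eqP tU; case/andP: (Pm _ PU).
    rewrite -/(t (t S)) tU => PS /eqP mS; rewrite PS /=.
    by move: mU; rewrite -mS in_toggle.
  case/andP => PS mS; case/andP: (Pm S PS) => PU /eqP mU.
  by rewrite PU {2}/t mU in_toggle mS /= {1}/t mU toggleK eqxx.
rewrite (eq_bigl _ _ E) -big_split /= big1 // => S /andP[_ /negPf mS].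
by rewrite /t /toggle mS cardsU1 mS exprS mulN1r addNr.
Qed.

Lemma sum_sign_subsets (H : {set T}) :
  \sum_(S : {set T} | S \subset H) (-1) ^+ #|S| = (H == set0)%:R :> R.
Proof.
have [->|/set0Pn[e eH]] := eqVneq H set0.
  rewrite (big_pred1 set0) ?cards0 // => S.
  by rewrite subset0.
rewrite (@sum_sign_toggle _ (fun=> e)) // => S SH; rewrite eqxx andbT.
rewrite /toggle; case: ifP => _.
  exact: subset_trans (subsetDl _ _) SH.
by rewrite subUset sub1set eH.
Qed.

Lemma sum_subsets_card (H : {set T}) (f : nat -> R) :
  \sum_(S : {set T} | S \subset H) f #|S| =
  \sum_(j < #|H|.+1) f j *+ 'C(#|H|, j).
Proof.
rewrite (partition_big (fun S : {set T} => inord #|S| : 'I_#|H|.+1) predT) //=.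
apply: eq_bigr => j _; rewrite -cards_draws -sumr_const.
apply: eq_big => [S|S /andP[SH /eqP<-]].
  rewrite !inE -val_eqE /=; case SH : (S \subset H) => //=.
  by rewrite inordK // ltnS subset_leq_card.
by rewrite inordK // ltnS subset_leq_card.
Qed.

End Toggle.

Lemma set2_eq (T : finType) (a b c d : T) :
  [set a; b] = [set c; d] -> (a = c /\ b = d) \/ (a = d /\ b = c).
Proof.
move=> E; have /setP E' := E.
have := E' a; have := E' b; have := E' c; have := E' d.
rewrite !inE !eqxx ?orbT /=.
move=> /orP[]/eqP ? /orP[]/eqP ? /esym/orP[]/eqP ? /esym/orP[]/eqP ?; subst;
  by [left | right].
Qed.

Section Expansion.
Variables (V I : finType) (R : comNzRingType) (z : I -> R).
Implicit Types (S : {set {set V}}) (k : {ffun V -> I}) (g : rel V).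

Definition edge_rel (T : finType) (S : {set {set T}}) : rel T :=
  fun u v => [set u; v] \in S.

Definition const_on S k : bool :=
  [forall u, forall v, ([set u; v] \in S) ==> (k u == k v)].

Definition mono_edges g k : {set {set V}} :=
  [set e in edges g | [forall u in e, forall v in e, k u == k v]].

Lemma mono_edgesP g k u v : [set u; v] \in edges g ->
  ([set u; v] \in mono_edges g k) = (k u == k v).
Proof.
move=> He; rewrite !inE He /=; apply/forall_inP/idP => /= [H|/eqP H].
  by have /forall_inP := H u (set21 u v); apply; apply: set22.
move=> a /set2P Ha; apply/forall_inP => b /set2P Hb.
by case: Ha Hb => -> [] ->; rewrite ?H.
Qed.

Lemma edgesP g e : e \in edges g -> exists u v, g u v /\ e = [set u; v].
Proof. by case/imsetP => -[u v]; rewrite inE /= => guv ->; exists u, v. Qed.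

Lemma mem_edges g u v : g u v -> [set u; v] \in edges g.
Proof. by move=> guv; apply/imsetP; exists (u, v); rewrite ?inE. Qed.

Lemma const_onE g S k :
  S \subset edges g -> const_on S k = (S \subset mono_edges g k).
Proof.
move=> /subsetP Sg; apply/'forall_forallP/subsetP => /= H.
  move=> e eS; have [u [v [guv E]]] := edgesP (Sg e eS); move: eS; rewrite E => eS.
  by rewrite mono_edgesP ?mem_edges //; have /implyP := H u v; apply.
move=> u v; apply/implyP => uvS.
by rewrite -(@mono_edgesP g) ?H // Sg.
Qed.

Lemma properE g k :
  [forall u, forall v, g u v ==> (k u != k v)] = (mono_edges g k == set0).
Proof.
apply/'forall_forallP/eqP => /= [H|H u v].
  apply/setP => e; rewrite in_set0; apply/negP => He.
  have /edgesP[u [v [guv E]]] : e \in edges g by move: He; rewrite inE => /andP[].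
  move: He; rewrite E mono_edgesP ?mem_edges //.
  by have /implyP/(_ guv)/negPf -> := H u v.
apply/implyP => guv; apply/negP; rewrite -(@mono_edgesP g) ?mem_edges //.
by rewrite H inE.
Qed.

Definition mono_sum S : R := \sum_(k | const_on S k) \prod_v z (k v).

(** [Q] is any family whose signed count still detects the absence of monochromatic edges: all edge
    sets give inclusion-exclusion, those without broken circuit give Whitney's expansion. The result
    follows by exchanging the sums over colourings and edge sets. *)
Lemma chrom_at_expansion g (Q : pred {set {set V}}) :
  (forall k, \sum_(S : {set {set V}} | (S \subset mono_edges g k) && Q S) (-1) ^+ #|S|
             = (mono_edges g k == set0)%:R :> R) ->
  chrom_at z g =
  \sum_(S : {set {set V}} | (S \subset edges g) && Q S) (-1) ^+ #|S| * mono_sum S.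
Proof.
move=> HQ; rewrite /chrom_at big_mkcond /=.
under eq_bigr => k _.
  have -> : (if [forall u, forall v, g u v ==> (k u != k v)]
             then \prod_v z (k v) else 0) =
      (\sum_(S : {set {set V}} | (S \subset mono_edges g k) && Q S) (-1) ^+ #|S|) * \prod_v z (k v).
    by rewrite HQ properE; case: ifP; rewrite ?mul1r ?mul0r.
  rewrite mulr_suml; over.
rewrite (exchange_big_dep (fun S : {set {set V}} => (S \subset edges g) && Q S)) /=; last first.
  move=> k S _ /andP[SH ->]; rewrite andbT; apply: subset_trans SH _.
  by apply/subsetP => e; rewrite inE => /andP[].
apply: eq_bigr => S /andP[Sg QS]; rewrite mulr_sumr.
by apply: eq_bigl => k; rewrite QS andbT (const_onE _ Sg).
Qed.

Lemma chrom_at_subsets g :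
  chrom_at z g = \sum_(S : {set {set V}} | S \subset edges g) (-1) ^+ #|S| * mono_sum S.
Proof.
rewrite (@chrom_at_expansion g predT) => [|k].
  by apply: eq_bigl => S; rewrite andbT.
by rewrite -sum_sign_subsets; apply: eq_bigl => S; rewrite andbT.
Qed.

End Expansion.

Lemma edge_rel_sym (V : finType) (S : {set {set V}}) : connect_sym (edge_rel S).
Proof. by apply: sym_connect_sym => u v; rewrite /edge_rel setUC. Qed.

Section Components.
Variables (V : finType) (S : {set {set V}}).

Local Notation comp := {r : V | roots (edge_rel S) r}.

Definition comp_of (v : V) : comp :=
  exist _ (fingraph.root (edge_rel S) v) (roots_root (@edge_rel_sym V S) v).

Definition comp_size (r : comp) : nat := #|[pred v | comp_of v == r]|.

Lemma comp_of_val (r : comp) : comp_of (val r) = r.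
Proof. by apply: val_inj; apply/eqP; apply: (valP r). Qed.

Lemma comp_size_gt0 r : (0 < comp_size r)%N.
Proof. by apply/card_gt0P; exists (val r); rewrite inE comp_of_val. Qed.

Lemma sum_comp_size : (\sum_r comp_size r = #|V|)%N.
Proof.
rewrite -sum1_card (partition_big comp_of predT) //=.
by apply: eq_bigr => r _; rewrite /comp_size -sum1_card.
Qed.

Lemma card_comp : #|{: comp}| = ncomp S.
Proof.
rewrite card_sig /ncomp /n_comp_mem; apply: eq_card => v.
by rewrite !inE andbT.
Qed.

Lemma const_on_comp (I : finType) (k : {ffun V -> I}) v :
  const_on S k -> k (val (comp_of v)) = k v.
Proof.
move=> /'forall_forallP/= H; have := connect_root (edge_rel S) v.
case/connectP => p; rewrite /=; move: (fingraph.root _ _) => r.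
elim: p v => [|a p IH] v /=; first by move=> _ ->.
case/andP => va pp E; rewrite (IH a pp E); apply/eqP.
by rewrite eq_sym; have /implyP := H v a; apply.
Qed.

(** A colouring constant along [S] is a free choice of one colour per component; distributing the
    product of power sums lists these choices. *)
Lemma mono_sum_comp (I : finType) (R : comNzRingType) (z : I -> R) :
  mono_sum z S = \prod_r psum z (comp_size r).
Proof.
rewrite /psum bigA_distr_bigA /=.
pose h (f : {ffun comp -> I}) : {ffun V -> I} := [ffun v => f (comp_of v)].
pose h' (k : {ffun V -> I}) : {ffun comp -> I} := [ffun r => k (val r)].
rewrite /mono_sum (reindex_onto h h') /=; last first.
  by move=> k Hk; apply/ffunP => v; rewrite !ffunE (const_on_comp _ Hk).
apply: eq_big => [f|f _].
  have -> : h' (h f) == f.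
    by apply/eqP/ffunP => r; rewrite !ffunE comp_of_val.
  rewrite andbT; apply/'forall_forallP => u v; apply/implyP => uvS.
  rewrite !ffunE; suff -> : comp_of u = comp_of v by [].
  apply: val_inj; apply/eqP; rewrite root_connect; last exact: edge_rel_sym.
  exact: connect1.
rewrite (partition_big comp_of predT) //=; apply: eq_bigr => r _.
rewrite -prodr_const; apply: eq_big => [v|v /eqP<-]; first by rewrite inE.
by rewrite ffunE.
Qed.

(** All weights are taken to be 1. With two colours, this reduces identities between component
    counts to bijections of colourings. *)
Lemma card_const_on (I : finType) :
  #|[pred k : {ffun V -> I} | const_on S k]| = (#|I| ^ ncomp S)%N.
Proof.
apply/eqP; rewrite -(eqr_nat int) natrX -card_comp; apply/eqP.
have <- : mono_sum (fun _ : I => 1%:Z) S = #|[pred k : {ffun V -> I} | const_on S k]|%:R.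
  rewrite -sumr_const; apply: eq_big => [k|k _]; first by rewrite inE.
  by rewrite big1.
rewrite mono_sum_comp -prodr_const; apply: eq_bigr => r _.
by rewrite /psum; under eq_bigr do rewrite expr1n; rewrite sumr_const.
Qed.

End Components.

(** * Broken circuits and forests *)

Section Cycles.
Variables (V : finType) (g : rel V) (w : {set V} -> nat).
Hypothesis g_sym : forall u v, g u v = g v u.
Hypothesis g_irr : forall u, ~~ g u u.
Implicit Types (S : {set {set V}}) (t : seq V) (e : {set V}).

Lemma edgeE u v : ([set u; v] \in edges g) = g u v.
Proof.
apply/idP/idP => [/edgesP[a [b [gab /set2_eq]]]|]; last exact: mem_edges.
by case=> [[-> ->]|[-> ->]] //; rewrite g_sym.
Qed.

Lemma mem_cycle_edges t x : x \in t -> [set x; next t x] \in cycle_edges t.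
Proof. by move=> xt; apply: imset_f. Qed.

Lemma cycle_edges_sub t : is_cycle_seq g t -> cycle_edges t \subset edges g.
Proof.
case/andP=> _ Ct; apply/subsetP => e /imsetP[x xt ->].
by rewrite edgeE; apply: next_cycle.
Qed.

(** A cycle repeats no vertex, so bounding its length by [#|V|] loses no cycle. *)
Lemma cycle_seq_tuple t (P : pred (seq V)) : is_cycle_seq g t -> P t ->
  [exists k : 'I_(#|V|).+1, exists u : k.-tuple V, P u].
Proof.
case/andP=> /andP[_ Ut] _ Pt.
have st : (size t < #|V|.+1)%N by rewrite ltnS -(card_uniqP Ut) max_card.
apply/existsP; exists (Ordinal st); apply/existsP.
by exists (in_tuple t).
Qed.

Lemma has_cycleP S :
  reflect (exists2 t, is_cycle_seq g t & cycle_edges t \subset S)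
          (has_cycle g S).
Proof.
apply: (iffP idP) => [/existsP[k /existsP[t /andP[Ct tS]]]|[t Ct tS]].
  by exists t.
apply: (@cycle_seq_tuple t (fun u => is_cycle_seq g u && (cycle_edges u \subset S))) => //.
by rewrite Ct.
Qed.

Definition broken_circuit_at S t e : bool :=
  [&& is_cycle_seq g t, e \in cycle_edges t,
      [forall e' in cycle_edges t, w e <= w e']%N &
      cycle_edges t :\ e \subset S].

Definition closes_broken_circuit S e : bool :=
  [exists k : 'I_(#|V|).+1, exists t : k.-tuple V, broken_circuit_at S t e].

Lemma closesP S e :
  reflect (exists t, broken_circuit_at S t e) (closes_broken_circuit S e).
Proof.
apply: (iffP idP) => [/existsP[k /existsP[t Ht]]|[t Ht]]; first by exists t.
by apply: (@cycle_seq_tuple t (fun u => broken_circuit_at S u e)) => //; case/and4P: Ht.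
Qed.

Lemma no_broken_circuitP S :
  reflect (forall e, ~~ closes_broken_circuit S e) (no_broken_circuit g w S).
Proof.
apply: (iffP idP) => [H e|H].
  apply/negP => /existsP[k /existsP[t /and4P[Ct et emin tS]]].
  move/'forall_forallP: H => /(_ k t)/implyP/(_ Ct)/forall_inP/(_ e et).
  by rewrite emin tS.
apply/'forall_forallP => k t; apply/implyP => Ct; apply/forall_inP => e et.
apply/implyP => emin; apply: contra (H e) => tS; apply/closesP; exists t.
exact/and4P.
Qed.

Lemma path_next_const (I : eqType) (f : V -> V) (c : V -> I) x y q :
  path (frel f) y (rcons q x) ->
  (forall v, v \in y :: q -> c (f v) = c v) -> c x = c y.
Proof.
elim: q y => [|a q IH] y /=.
  by rewrite andbT => /eqP<- /(_ y); apply; rewrite mem_seq1.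
case/andP => /eqP E pa H; rewrite -(H y) ?mem_head // E.
by apply: IH pa _ => v vq; apply: H; rewrite inE vq orbT.
Qed.

(** Going round the cycle from one end of [e] to the other, the colour never changes. *)
Lemma cycle_mono_flat (I : finType) (k : {ffun V -> I}) t e :
  is_cycle_seq g t -> e \in cycle_edges t ->
  cycle_edges t :\ e \subset mono_edges g k -> e \in mono_edges g k.
Proof.
move=> Ct /imsetP[x xt E] /subsetP Hk.
have tE := subsetP (cycle_edges_sub Ct).
have xE : [set x; next t x] \in edges g by apply/tE/mem_cycle_edges.
rewrite E mono_edgesP //.
case/andP: (Ct) => /andP[szt Ut] _.
have := cycle_next Ut; case: (rot_to xt) => i p Ep.
rewrite -(rot_cycle i) Ep /=.
case: p Ep => [|y q] Ep.
  by move: szt; rewrite -(size_rot i) Ep.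
rewrite rcons_cons /= => /andP[/eqP Ey Hp].
rewrite Ey; apply/eqP; apply: (path_next_const Hp) => v vq.
have Uxyq : uniq (x :: y :: q) by rewrite -Ep rot_uniq.
have vt : v \in t by rewrite -(mem_rot i) Ep inE vq orbT.
have vx : v != x.
  by apply: contraTneq vq => ->; case/andP: Uxyq.
apply/esym/eqP; rewrite -(@mono_edgesP _ _ g); last exact/tE/mem_cycle_edges.
apply: Hk; rewrite 2!inE mem_cycle_edges // andbT E Ey.
(* The edge leaving [v] could be [e] again only if [v] is [x], or if the successor of [y] is [x];
   the latter would be a cycle of length two. *)
apply/negP => /eqP/set2_eq[[/eqP]|[vy nv]]; first by rewrite (negPf vx).
move: szt Hp Uxyq; rewrite -(size_rot i) Ep; case: (q) => [|a r] //= _.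
case/andP => /eqP; rewrite -vy nv => <- _.
by rewrite !inE eqxx !orbT.
Qed.

(** A cycle inside [S] contains its own broken circuit. *)
Lemma no_broken_circuit_acyclic S : no_broken_circuit g w S -> ~~ has_cycle g S.
Proof.
move=> /no_broken_circuitP H; apply/has_cycleP => -[t Ct tS].
have [x xt] : exists x, x \in t.
  by case: t Ct tS => [|x t] // _ _; exists x; rewrite mem_head.
have [e et emin] := arg_minnP w (mem_cycle_edges xt).
have /negP := H e; apply; apply/closesP; exists t; apply/and4P; split => //.
  by apply/forall_inP.
exact: subset_trans (subsetDl _ _) tS.
Qed.

Hypothesis w_inj : {in edges g &, injective w}.

Lemma closes_edge S e : closes_broken_circuit S e -> e \in edges g.
Proof. by case/closesP => t /and4P[Ct et _ _]; apply: (subsetP (cycle_edges_sub Ct)). Qed.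

Definition top_closing S e : bool :=
  closes_broken_circuit S e &&
  [forall e', closes_broken_circuit S e' ==> (w e' <= w e)%N].

(** The default [set0] is reached only if [S] contains no broken circuit. *)
Definition top_edge S : {set V} := odflt set0 [pick e | top_closing S e].

Lemma top_edge_eq S e : top_closing S e -> top_edge S = e.
Proof.
rewrite /top_edge; case: pickP => [e' /=|/(_ e) -> //].
case/andP => Me' /forallP He' /andP[Me /forallP He]; apply: w_inj.
- exact: closes_edge Me'.
- exact: closes_edge Me.
apply/eqP; rewrite eqn_leq.
by rewrite (implyP (He e')) // (implyP (He' e)).
Qed.

Lemma top_edgeP S : ~~ no_broken_circuit g w S -> top_closing S (top_edge S).
Proof.
move=> H; have [e Me] : exists e, closes_broken_circuit S e.
  apply/existsP; apply: contraR H; rewrite negb_exists => /forallP H.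
  exact/no_broken_circuitP.
have [e' Me' He'] := arg_maxnP w Me.
suff T : top_closing S e' by rewrite (top_edge_eq T).
by rewrite /top_closing Me'; apply/forallP => f; apply/implyP/He'.
Qed.

(* A broken circuit through [e] is closed by an edge lighter than [e], so
   toggling the heaviest closing edge [e] leaves it the heaviest one. *)
Lemma top_closing_toggle S e : top_closing S e -> top_closing (toggle e S) e.
Proof.
case/andP => /closesP[t Ht] /forallP Hmax; apply/andP; split.
  apply/closesP; exists t; case/and4P: Ht => Ct et emin tS; apply/and4P; split=> //.
  apply/subsetP => f; rewrite 2!inE => /andP[fe ft].
  have fS : f \in S by apply: (subsetP tS); rewrite 2!inE fe.
  by rewrite /toggle; case: ifP => _; rewrite !inE fS ?fe ?orbT.
apply/forallP => f; apply/implyP => /closesP[u /and4P[Cu fu fmin uS]].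
have [eu|eu] := boolP (e \in cycle_edges u).
  by move/forall_inP: fmin; apply.
apply: (implyP (Hmax f)); apply/closesP; exists u; apply/and4P; split=> //.
apply/subsetP => h hu; have := subsetP uS h hu.
have he : h != e by apply: contraTneq hu => ->; rewrite 2!inE (negPf eu) andbF.
by rewrite /toggle; case: ifP => _; rewrite !inE (negPf he).
Qed.

(** The edge sets containing a broken circuit cancel by toggling [top_edge]. Toggling adds only
    monochromatic edges, by [cycle_mono_flat]. *)
Lemma sum_sign_no_broken_circuit (R : comNzRingType) (I : finType)
    (k : {ffun V -> I}) :
  \sum_(S : {set {set V}} | (S \subset mono_edges g k) && no_broken_circuit g w S)
     (-1) ^+ #|S| = (mono_edges g k == set0)%:R :> R.
Proof.
rewrite -sum_sign_subsets [RHS](bigID (no_broken_circuit g w)) /=.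
rewrite -[LHS]addr0; congr (_ + _); apply/esym.
apply: (@sum_sign_toggle _ _ (fun S => (S \subset mono_edges g k) &&
  ~~ no_broken_circuit g w S) top_edge) => S /andP[Sk nS].
have T := top_edgeP nS; have T' := top_closing_toggle T.
rewrite (top_edge_eq T') eqxx andbT; apply/andP; split.
  rewrite /toggle; case: ifP => _; first exact: subset_trans (subsetDl _ _) Sk.
  rewrite subUset Sk andbT sub1set.
  case/andP: T => /closesP[t /and4P[Ct et _ tS]] _.
  by apply: cycle_mono_flat Ct et _; apply: subset_trans tS Sk.
by apply/negP => /no_broken_circuitP/(_ (top_edge S)); case/andP: T' => ->.
Qed.

Lemma internal_forestE S :
  internal_forest g w S = (S \subset edges g) && no_broken_circuit g w S.
Proof.
rewrite /internal_forest /spanning_forest; case: (boolP (no_broken_circuit _ _ _)) => H.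
  by rewrite no_broken_circuit_acyclic ?andbT.
by rewrite !andbF.
Qed.

(** Whitney's theorem with colour weights; by [mono_sum_comp] each term is a signed product of power
    sums. *)
Lemma chrom_at_internal (I : finType) (R : comNzRingType) (z : I -> R) :
  chrom_at z g = \sum_(S | internal_forest g w S) (-1) ^+ #|S| * mono_sum z S.
Proof.
rewrite (chrom_at_expansion z (@sum_sign_no_broken_circuit R I)).
by apply: eq_bigl => S; rewrite internal_forestE.
Qed.

(** * Component counts and proper colourings of forests *)

Lemma spanning_forest_sub S S' :
  S' \subset S -> spanning_forest g S -> spanning_forest g S'.
Proof.
move=> SS' /andP[Sg Sc]; rewrite /spanning_forest (subset_trans SS' Sg) /=.
apply: contra Sc => /has_cycleP[t Ct tS]; apply/has_cycleP; exists t => //.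
exact: subset_trans SS'.
Qed.

(** A path between the ends that avoids the edge would close a cycle with it. *)
Lemma forest_edge_disconnects S u v : spanning_forest g S -> [set u; v] \in S ->
  ~~ connect (edge_rel (S :\ [set u; v])) u v.
Proof.
case/andP => Sg Sc uvS; apply: contra Sc => /connectP[p pp].
case/shortenP: pp => p' pp' Up' _ Ev.
have guv : g u v by rewrite -edgeE (subsetP Sg).
have uv : u != v by apply: contraTneq guv => ->; apply: g_irr.
have CS : cycle (edge_rel S) (u :: p').
  rewrite /= rcons_path -Ev /edge_rel setUC uvS andbT.
  by apply: sub_path pp' => a b; rewrite /edge_rel !inE => /andP[].
apply/has_cycleP; exists (u :: p'); last first.
  by apply/subsetP => e /imsetP[x xt ->]; exact: (next_cycle CS xt).
rewrite /is_cycle_seq Up' andbT (sub_cycle _ CS) ?andbT; last first.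
  by move=> a b abS; rewrite -edgeE; apply: (subsetP Sg).
(* An empty path would make the edge a loop and a one-step path would be the deleted edge, so the
   cycle has at least three vertices. *)
case: p' pp' Ev {Up' CS} => [|a [|b p']] //=.
  by move=> _ E; rewrite E eqxx in uv.
by move=> + E; rewrite E /edge_rel !inE eqxx.
Qed.

(** Among the two-colourings constant along the smaller set, those agreeing at [u] and [v] are the
    ones constant along [S]. Flipping the colours on the component of [u] exchanges them with the
    others, so the count doubles. *)
Lemma ncomp_del S u v : spanning_forest g S -> [set u; v] \in S ->
  ncomp (S :\ [set u; v]) = (ncomp S).+1.
Proof.
move=> SF uvS; set S' := S :\ _.
have dis := forest_edge_disconnects SF uvS.
apply/eqP; rewrite -(@eqn_exp2l 2) // expnS mul2n -addnn -card_bool -!card_const_on.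
have constS (k : {ffun V -> bool}) : const_on S k = const_on S' k && (k u == k v).
  apply/'forall_forallP/andP => /= [H|[/'forall_forallP/= H /eqP kuv] a b].
    split; last by have /implyP := H u v; apply.
    apply/'forall_forallP => a b; apply/implyP; rewrite !inE => /andP[_].
    by move/implyP: (H a b).
  apply/implyP => abS.
  have [/set2_eq[][-> ->]|ne] := eqVneq [set a; b] [set u; v]; rewrite ?kuv //.
  by have /implyP := H a b; apply; rewrite !inE ne.
pose h (k : {ffun V -> bool}) := [ffun x => k x (+) connect (edge_rel S') u x].
have hK : involutive h.
  by move=> k; apply/ffunP => x; rewrite !ffunE -addbA addbb addbF.
rewrite -(cardID [pred k : {ffun V -> bool} | k u == k v]
                 [pred k : {ffun V -> bool} | const_on S' k]).
apply/eqP; congr (_ + _)%N; first by apply: eq_card => k; rewrite !inE constS.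
rewrite -(card_image (inv_inj hK)); apply: eq_card => k.
have hS' k' : const_on S' k' -> const_on S' (h k').
  move=> /'forall_forallP/= H; apply/'forall_forallP => a b; apply/implyP => ab.
  rewrite !ffunE; have /implyP/(_ ab)/eqP -> := H a b; apply/eqP; congr (_ (+) _).
  by apply: same_connect1r; first exact: edge_rel_sym.
have huv k' : (h k' u == h k' v) = ~~ (k' u == k' v).
  by rewrite !ffunE connect0 (negPf dis); case: (k' u); case: (k' v).
rewrite -[k in LHS]hK mem_image; last exact: inv_inj.
rewrite !inE constS huv negbK andbC.
rewrite (_ : const_on S' (h k) = const_on S' k) //; apply/idP/idP; last exact: hS'.
by move/hS'; rewrite hK.
Qed.

Lemma card_spanning_forest S :
  spanning_forest g S -> (#|S| + ncomp S = #|V|)%N.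
Proof.
move En : #|S| => n; elim: n S En => [|n IH] S En SF.
  move/eqP: En; rewrite cards_eq0 => /eqP->.
  apply/eqP; rewrite add0n -(@eqn_exp2l 2) // -card_bool -card_const_on -card_ffun.
  by apply/eqP/eq_card => k; rewrite !inE; apply/'forall_forallP => a b; rewrite inE.
have [e eS] : exists e, e \in S by apply/set0Pn; rewrite -card_gt0 En.
have [u [v [guv E]]] : exists u v, g u v /\ e = [set u; v].
  by apply: edgesP; case/andP: SF => /subsetP + _; apply.
move: eS; rewrite E => uvS.
have := cardsD1 [set u; v] S; rewrite uvS En add1n => -[/esym/IH].
move/(_ (spanning_forest_sub (subsetDl _ _) SF)).
by rewrite (ncomp_del SF uvS) addnS addSn.
Qed.

Lemma edges_edge_rel S : S \subset edges g -> edges (edge_rel S) = S.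
Proof.
move=> /subsetP Sg; apply/setP => e; apply/idP/idP => [/edgesP[u [v [uv ->]]] //|eS].
have [u [v [_ E]]] := edgesP (Sg e eS); rewrite E in eS *.
exact: mem_edges.
Qed.

(** Every subset [S'] of a forest is a forest with [#|V| - #|S'|] components, so the subset
    expansion with weights 1 is a binomial sum. *)
Lemma card_proper_on (R : comNzRingType) S (x : nat) : spanning_forest g S ->
  #|[pred c : {ffun V -> 'I_x} | proper_on S c]|%:R
  = x%:R ^+ ncomp S * (x%:R - 1) ^+ #|S| :> R.
Proof.
move=> SF; have /andP[Sg _] := SF.
have -> : #|[pred c : {ffun V -> 'I_x} | proper_on S c]|%:R
        = chrom_at (fun _ : 'I_x => 1 : R) (edge_rel S).
  rewrite -sumr_const; apply: eq_big => [c|c _].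
    by rewrite inE.
  by rewrite big1.
rewrite chrom_at_subsets edges_edge_rel //.
transitivity (\sum_(S' : {set {set V}} | S' \subset S)
   (-1) ^+ #|S'| * x%:R ^+ (#|V| - #|S'|) : R).
  apply: eq_bigr => S' SS'; congr (_ * _).
  have /card_spanning_forest <- := spanning_forest_sub SS' SF.
    rewrite addKn -{3}(card_ord x) -natrX -card_const_on -sumr_const.
  by apply: eq_big => [k|k _]; rewrite ?inE ?big1.
rewrite (sum_subsets_card S (fun j => (-1) ^+ j * x%:R ^+ (#|V| - j) : R)).
rewrite exprDn mulr_sumr; apply: eq_bigr => j _.
rewrite -(card_spanning_forest SF) addnC -addnBA -1?ltnS ?ltn_ord // exprD.
by rewrite mulrnAr; congr (_ *+ _); rewrite mulrC mulrA.
Qed.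

End Cycles.

(** * Power sums *)

Section Newton.

Lemma deriv_prod (R : comNzRingType) (I : eqType) (s : seq I) (f : I -> {poly R}) :
  uniq s ->
  (\prod_(i <- s) f i)^`() =
  \sum_(i <- s) (f i)^`() * \prod_(j <- s | j != i) f j.
Proof.
elim: s => [|x s IH] /=; first by rewrite !big_nil derivC.
case/andP => xs Us; rewrite !big_cons derivM IH // eqxx /=; congr (_ * _ + _).
  rewrite [LHS]big_seq [RHS]big_seq_cond; apply: eq_bigl => j.
  by case: (boolP (j \in s)) => //= js; apply/esym; apply: contraNneq xs => <-.
rewrite mulr_sumr !big_seq; apply: eq_bigr => i si.
rewrite big_cons ifT; first by rewrite mulrCA.
by apply: contraNneq xs => ->.
Qed.

Variables (R : comNzRingType) (I : finType) (z : I -> R).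

Local Notation P := (\prod_i (1 - z i *: 'X)).

(** Division of [P] by its factor at [i], whose inverse power series is geometric. *)
Lemma coef_prod_linear_but_one i k :
  (\prod_(j | j != i) (1 - z j *: 'X))`_k =
  \sum_(j < k.+1) z i ^+ (k - j) * P`_j.
Proof.
set Q := \prod_(j | j != i) _.
have -> : P = Q - z i *: (Q * 'X).
  by rewrite (bigD1 i) //= -/Q mulrBl mul1r -scalerAl mulrC.
elim: k => [|k IH].
  by rewrite big_ord1 subnn mul1r coefB coefZ coefMX mulr0 subr0.
rewrite big_ord_recr /= subnn mul1r coefB coefZ coefMX /=.
under eq_bigr => j _ do rewrite subSn -1?ltnS // exprS -mulrA.
by rewrite -mulr_sumr -IH addrC subrK.
Qed.

(** Compare coefficients in the derivative of [P], where each factor contributes [- z i] times the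
    product of the others. *)
Lemma newton_identity k :
  P`_k.+1 *+ k.+1 = - \sum_(j < k.+1) psum z (k - j).+1 * P`_j.
Proof.
rewrite -coef_deriv deriv_prod ?index_enum_uniq // coef_sum.
transitivity (\sum_i \sum_(j < k.+1) - (z i ^+ (k - j).+1 * P`_j)).
  apply: eq_bigr => i _.
  rewrite derivB derivC sub0r derivZ derivX alg_polyC mulNr mul_polyC coefN coefZ.
  rewrite coef_prod_linear_but_one mulr_sumr -sumrN.
  by apply: eq_bigr => j _; rewrite exprS mulrA.
rewrite exchange_big -sumrN /=; apply: eq_bigr => j _.
by rewrite sumrN mulr_suml.
Qed.

End Newton.

Lemma poly_reverse_roots (F : closedFieldType) (n : nat) (f : {poly F}) :
  (size f <= n.+1)%N -> f`_0 = 1 ->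
  exists z : 'I_n -> F, f = \prod_i (1 - z i *: 'X).
Proof.
move=> sf f0; have [r Er] := closed_field_poly_normal f.
have nz : f != 0 by apply: contra_eqN f0 => /eqP->; rewrite coef0 eq_sym oner_neq0.
have sr : (size r <= n)%N.
  move: sf; rewrite Er size_scale ?lead_coef_eq0 //.
  by rewrite size_prod_XsubC.
(* Beyond the end of [r] the entry is 0, with inverse 0, so the surplus factors are 1. *)
exists (fun i => (r`_i)^-1).
have H0 : lead_coef f * \prod_(a <- r) (- a) = 1.
  rewrite -[RHS]f0 [in RHS]Er coefZ; congr (_ * _); rewrite -horner_coef0 horner_prod.
  by apply: eq_bigr => a _; rewrite hornerXsubC sub0r.
have r0 a : a \in r -> a != 0.
  move=> ar; apply/negP => /eqP a0; move: H0; rewrite (big_rem a) //= a0.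
  by rewrite oppr0 mul0r mulr0 => /eqP; rewrite eq_sym oner_eq0.
rewrite -(big_mkord xpredT (fun i => 1 - (r`_i)^-1 *: 'X)).
rewrite (big_cat_nat (n := size r)) //= [X in _ * X]big_nat_cond.
rewrite [X in _ * X]big1 ?mulr1; last first.
  by move=> i /andP[/andP[ri _] _]; rewrite nth_default // invr0 scale0r subr0.
rewrite -(big_nth 0 xpredT (fun a => 1 - a^-1 *: 'X)).
have -> : \prod_(a <- r) (1 - a^-1 *: 'X) =
          \prod_(a <- r) ((- a)^-1 *: ('X - a%:P)).
  rewrite !big_seq; apply: eq_bigr => a /r0 a0.
  by rewrite invrN scaleNr scalerBr opprB -[_ *: a%:P]mul_polyC -polyCM mulVf.
by rewrite scaler_prod prodfV (mulr1_eq (etrans (mulrC _ _) H0)) -Er.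
Qed.

(* The coefficients of [(1 - y t) ^ (x / y) = exp (- sum_k x y^(k-1) t^k / k)]:
   its reciprocal roots have power sums [x y^(k-1)]. *)
Fixpoint binomial_coef_series (F : fieldType) (x y : F) (k : nat) : F :=
  if k is j.+1 then (y *+ j - x) * binomial_coef_series x y j / j.+1%:R else 1.

(** Newton's identities with [x * y ^+ k] as power sum of index [k.+1]. In the inductive step, all
    summands but the last share a factor [y] whose removal leaves the previous sum. *)
Lemma binomial_coef_series_newton (F : numFieldType) (x y : F) k :
  binomial_coef_series x y k.+1 *+ k.+1 =
  - \sum_(j < k.+1) x * y ^+ (k - j) * binomial_coef_series x y j.
Proof.
have E j : binomial_coef_series x y j.+1 *+ j.+1 = (y *+ j - x) * binomial_coef_series x y j.
  by rewrite -[LHS]mulr_natr /= divfK // pnatr_eq0.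
elim: k => [|k IH].
  by rewrite E big_ord1 /=; ring.
rewrite E big_ord_recr /= -/(binomial_coef_series x y k.+1) subnn expr0 mulr1.
under eq_bigr => j _ do rewrite subSn -1?ltnS // exprS mulrCA -mulrA.
rewrite -mulr_sumr -[\sum_(_ < _) _]opprK -IH.
by move: (binomial_coef_series x y k.+1) => c; rewrite -[c *+ _]mulr_natr -[y *+ _]mulr_natr; ring.
Qed.

(** Since the product has constant coefficient 1, Newton's identities determine its power sums from
    its coefficients. Hence [z] is read off from the series truncated at degree [n]. *)
Lemma geometric_psum_exists (n : nat) (x y : algC) :
  exists z : 'I_n -> algC,
    forall k, (k < n)%N -> psum z k.+1 = x * y ^+ k.
Proof.
have [||z Ez] := @poly_reverse_roots algC n (\poly_(k < n.+1) binomial_coef_series x y k).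
- exact: size_poly.
- by rewrite coef_poly.
exists z => k; elim/ltn_ind: k => k IH kn.
have coefE j : (j <= n)%N -> (\prod_i (1 - z i *: 'X))`_j = binomial_coef_series x y j.
  by move=> jn; rewrite -Ez coef_poly ltnS jn.
have := newton_identity z k; rewrite coefE // binomial_coef_series_newton => /oppr_inj.
(* Only the summand at 0 contains the power sum of index [k.+1]; the others agree by induction. *)
rewrite !big_ord_recl /= !subn0 coefE // mulr1 mulr1.
rewrite [X in _ + X = _](_ : _ = \sum_(i < k) psum z (k - lift ord0 i).+1 *
     (\prod_i0 (1 - z i0 *: 'X))`_(lift ord0 i)); first by move/addIr.
apply: eq_bigr => j _; have jk := ltn_ord j.
by rewrite IH ?coefE //; rewrite /= /bump; lia.
Qed.

(** The path recursion becomes [x] times an expression that a geometric sum of ratio [1 - x] shows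
    to be 1. *)
Lemma path_chrom_const (R : comNzRingType) (I : finType) (z : I -> R) (n : nat) (x : R) :
  (forall k, (k < n)%N -> psum z k.+1 = x * (x - 1) ^+ k) ->
  forall m, (0 < m <= n)%N -> path_chrom z m = x.
Proof.
move=> Hz; elim/ltn_ind => -[|m] IH // /andP[_ mn].
(* The last summand is separated because [path_chrom z 0] is 1, not [x]. *)
rewrite path_chrom_rec big_ord_recr /= subnn /= mulr1 Hz //.
have sgn j : (1 - x) ^+ j = (-1) ^+ j * (x - 1) ^+ j by rewrite -exprNn opprB.
have -> : \sum_(j < m) (-1) ^+ j * psum z j.+1 * path_chrom z (m - j)
        = x * (x * \sum_(j < m) (1 - x) ^+ j).
  rewrite mulrA mulr_sumr; apply: eq_bigr => j _; have jm := ltn_ord j.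
  rewrite IH ?Hz; try lia.
  by rewrite sgn; move: (_ ^+ _) (_ ^+ _) => s t; ring.
have E k : x * (\sum_(j < k) (1 - x) ^+ j) + (1 - x) ^+ k = 1.
  elim: k => [|k IHk]; first by rewrite big_ord0 mulr0 add0r.
  by rewrite big_ord_recr /= exprS -[RHS]IHk; move: (\sum_(_ < _) _) (_ ^+ _) => s t; ring.
transitivity (x * (x * (\sum_(j < m) (1 - x) ^+ j) + (1 - x) ^+ m)).
  by rewrite sgn; move: (\sum_(_ < _) _) (_ ^+ _) (_ ^+ _) => s t u; ring.
by rewrite E mulr1.
Qed.

(** * The span of the products of path functions *)

Section Span.
Variables (R : comAlgType rat) (I : finType) (z : I -> R).

Definition path_span (n : nat) (q : R) : Prop :=
  exists a : n.-tuple 'I_n.+1 -> rat,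
    q = \sum_(l | is_partn l) a l *: \prod_(m <- parts l) path_chrom z m.

Lemma path_span0 n : path_span n 0.
Proof. by exists (fun=> 0); rewrite big1 // => l _; rewrite scale0r. Qed.

Lemma path_spanD n q r : path_span n q -> path_span n r -> path_span n (q + r).
Proof.
case=> a -> [b ->]; exists (fun l => a l + b l).
by rewrite -big_split; apply: eq_bigr => l _; rewrite scalerDl.
Qed.

Lemma path_spanZ n c q : path_span n q -> path_span n (c *: q).
Proof.
case=> a ->; exists (fun l => c * a l).
by rewrite scaler_sumr; apply: eq_bigr => l _; rewrite scalerA.
Qed.

Lemma path_span_sign n k q : path_span n q -> path_span n ((-1) ^+ k * q).
Proof.
move=> H; rewrite -signr_odd mulr_sign; case: ifP => // _.
by rewrite -scaleN1r; apply: path_spanZ.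
Qed.

Lemma path_span_sum n (J : Type) (s : seq J) (Q : pred J) (F : J -> R) :
  (forall j, Q j -> path_span n (F j)) -> path_span n (\sum_(j <- s | Q j) F j).
Proof.
move=> H; elim/big_ind: _ => //; [exact: path_span0 | exact: path_spanD].
Qed.

Lemma parts_neq0 n (l : n.-tuple 'I_n.+1) : all (fun q => q != 0%N) (parts l).
Proof. exact: filter_all. Qed.

Lemma sumn_parts n (l : n.-tuple 'I_n.+1) : is_partn l -> sumn (parts l) = n.
Proof.
case/andP => _ /eqP {2}<-; rewrite /parts.
by elim: (map _ _) => //= m s <-; case: eqP => //= ->.
Qed.

Lemma size_le_sumn (s : seq nat) :
  all (fun q => q != 0%N) s -> (size s <= sumn s)%N.
Proof. by elim: s => //= m s IH /andP[m0 /IH]; lia. Qed.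

Lemma partn_of_seq (s : seq nat) n :
  all (fun q => q != 0%N) s -> sumn s = n ->
  exists2 l : n.-tuple 'I_n.+1, is_partn l & perm_eq (parts l) s.
Proof.
(* Sort decreasingly and pad with zeros; nonzero parts ensure that [s] has at most [n] entries. *)
move=> s0 sn; pose t := sort geq s ++ nseq (n - size s) 0%N.
have st : size (map (@inord n) t) == n.
  rewrite size_map size_cat size_sort size_nseq subnKC // -[leqRHS]sn.
  exact: size_le_sumn.
have vt : map val (Tuple st) = t.
  rewrite /= -map_comp map_id_in // => m mt /=; apply: inordK; rewrite ltnS.
  move: mt; rewrite mem_cat mem_sort mem_nseq => /orP[ms|/andP[_ /eqP-> //]].
  by rewrite -sn; elim: (s) ms => //= a r IH; rewrite inE => /orP[/eqP->|/IH]; lia.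
have total_geq : total geq by move=> a b; rewrite /geq /= leq_total.
exists (Tuple st); rewrite /is_partn /parts vt.
  rewrite sumn_cat sumn_nseq mul0n addn0.
  have -> : sumn (sort geq s) = n by rewrite -sn; apply/perm_sumn; rewrite perm_sort.
  rewrite eqxx andbT /t.
  have tr : transitive geq by move=> a b c; rewrite /geq /=; lia.
  rewrite (sorted_pairwise tr) pairwise_cat -!(sorted_pairwise tr) sort_sorted //=.
  apply/andP; split; first by apply/allrelP => a b _; rewrite mem_nseq => /andP[_ /eqP->].
  rewrite (sorted_pairwise tr); elim: (_ - _)%N => //= k ->.
  by rewrite andbT; apply/allP => b; rewrite mem_nseq => /andP[_ /eqP->].
rewrite /t filter_cat [X in _ ++ X](_ : _ = [::]) ?cats0.
  rewrite (_ : filter _ _ = sort geq s) ?perm_sort //.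
  by apply/all_filterP; rewrite all_sort.
by apply/eqP; rewrite -size_eq0 size_filter count_nseq.
Qed.

Lemma path_span_seq (s : seq nat) n :
  all (fun q => q != 0%N) s -> sumn s = n ->
  path_span n (\prod_(m <- s) path_chrom z m).
Proof.
move=> s0 sn; have [l Hl ls] := partn_of_seq s0 sn.
exists (fun l' => (l' == l)%:R); rewrite (bigD1 l) //= eqxx scale1r [X in _ + X]big1.
  by rewrite addr0; apply/esym/perm_big.
by move=> l' /andP[_ /negPf->]; rewrite scale0r.
Qed.

(** The parts of two partitions together form a partition of the sum. *)
Lemma path_spanM n m q r :
  path_span n q -> path_span m r -> path_span (n + m) (q * r).
Proof.
case=> a -> [b ->]; rewrite mulr_suml; apply: path_span_sum => l Hl.
rewrite mulr_sumr; apply: path_span_sum => l' Hl'.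
rewrite -scalerAl -scalerAr; do 2!apply: path_spanZ.
rewrite -big_cat; apply: path_span_seq; first by rewrite all_cat !parts_neq0.
by rewrite sumn_cat !sumn_parts.
Qed.

(** In the path recursion the top power sum occurs only in the last summand, with a sign as
    coefficient; the other summands are covered by induction. *)
Lemma path_span_psum m : (0 < m)%N -> path_span m (psum z m).
Proof.
elim/ltn_ind: m => -[|m] // IH _.
have := path_chrom_rec z m; rewrite big_ord_recr /= subnn mulr1.
set s := \sum_(j < m) _ => E.
have -> : psum z m.+1 = (-1) ^+ m * (path_chrom z m.+1 + (-1) * s).
  by rewrite [path_chrom _ _]E mulN1r addrAC subrr add0r mulrA -expr2 sqrr_sign mul1r.
apply/path_span_sign/path_spanD.
  by have := @path_span_seq [:: m.+1] m.+1; rewrite big_seq1; apply => /=; lia.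
rewrite mulN1r -scaleN1r; apply/path_spanZ/path_span_sum => j _.
have jm := ltn_ord j.
rewrite -mulrA; apply: path_span_sign.
rewrite (_ : m.+1 = j.+1 + (m - j))%N; last lia.
apply: path_spanM; first by apply: IH; lia.
have := @path_span_seq [:: m - j]%N (m - j)%N; rewrite big_seq1; apply => /=; lia.
Qed.

Lemma path_span_mono_sum (V : finType) (S : {set {set V}}) :
  path_span #|V| (mono_sum z S).
Proof.
rewrite mono_sum_comp -(sum_comp_size S).
elim/big_ind2: _ => [|m q n r|r _].
- by have := @path_span_seq [::] 0%N; rewrite big_nil; apply.
- exact: path_spanM.
- exact/path_span_psum/comp_size_gt0.
Qed.

End Span.

(** * Evaluation of both expansions, and the theorem *)

Lemma chromE (V : finType) (g : rel V) N :
  chrom g N = chrom_at (fun i : 'I_N => 'X_i : {mpoly rat[N]}) g.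
Proof. by []. Qed.

Lemma mmap_chrom (V : finType) (g : rel V) N (z : 'I_N -> algC) :
  mmap (ratr : rat -> algC) z (chrom g N) = chrom_at z g.
Proof.
rewrite /chrom rmorph_sum; apply: eq_bigr => k _.
by rewrite rmorph_prod; apply: eq_bigr => v _; rewrite /= mmapX mmap1U.
Qed.

(** A component of size [s] contributes [x * (x - 1) ^+ s.-1], and in a forest the exponents add up
    to the number of edges. *)
Lemma mono_sum_forest (V : finType) (g : rel V) (R : comNzRingType)
    (I : finType) (z : I -> R) (x : R) (S : {set {set V}}) :
  (forall u v, g u v = g v u) -> (forall u, ~~ g u u) ->
  (forall k, (k < #|V|)%N -> psum z k.+1 = x * (x - 1) ^+ k) ->
  spanning_forest g S ->
  mono_sum z S = x ^+ ncomp S * (x - 1) ^+ #|S|.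
Proof.
move=> gs gi Hz SF; rewrite mono_sum_comp.
transitivity (\prod_(r : {r : V | roots (edge_rel S) r}) (x * (x - 1) ^+ (comp_size r).-1)).
  apply: eq_bigr => r _; have r0 := comp_size_gt0 r.
  rewrite -Hz ?prednK //; exact: max_card.
rewrite big_split /= prodr_const card_comp prodrXr; congr (_ * _ ^+ _).
apply/eqP; rewrite -(eqn_add2r (ncomp S)) (card_spanning_forest gs gi SF).
rewrite -card_comp -sum1_card -big_split /= -(sum_comp_size S).
by apply/eqP/eq_bigr => r _; rewrite addn1 prednK // comp_size_gt0.
Qed.

Theorem theorem4p5 (V : finType) (g : rel V) (w : {set V} -> nat) (x : nat) :
  (forall u v, g u v = g v u) -> (forall u, ~~ g u u) ->
  {in edges g &, injective w} ->
  (0 < x)%N ->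
  (exists a : (#|V|).-tuple 'I_(#|V|).+1 -> rat,
     chrom g #|V| =
     \sum_(l | is_partn l) a l *: chrom (@path_rel (parts l)) #|V|)
  /\
  (forall a : (#|V|).-tuple 'I_(#|V|).+1 -> rat,
     chrom g #|V| =
     \sum_(l | is_partn l) a l *: chrom (@path_rel (parts l)) #|V| ->
     \sum_(l | is_partn l) a l * (x%:R) ^+ (size (parts l))
     = (-1) ^+ #|V| *
       \sum_(F : {set {set V}} | internal_forest g w F)
         \sum_(c : {ffun V -> 'I_x} | proper_on F c) (-1) ^+ (ncomp F)).
Proof.
move=> gs gi winj _; split.
  have [a Ea] : path_span (fun i : 'I_#|V| => 'X_i : {mpoly rat[#|V|]}) #|V| (chrom g #|V|).
    rewrite chromE (chrom_at_internal gs winj).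
    by apply: path_span_sum => S _; apply/path_span_sign/path_span_mono_sum.
  exists a; rewrite Ea; apply: eq_bigr => l _.
  by rewrite chromE chrom_at_path ?parts_neq0.
move=> a /(congr1 (@mmap _ _ _ (ratr : rat -> algC) _)) H.
(* The ratio [x - 1] serves both expansions: each path function takes the value [x] at [z], and
   [mono_sum z] counts the proper colourings of a forest. *)
have [z Hz] := geometric_psum_exists #|V| (x%:R) (x%:R - 1).
move: (H z); rewrite mmap_chrom (chrom_at_internal gs winj) => {}H.
apply: (fmorph_inj (ratr : {rmorphism rat -> algC})).
transitivity (\sum_(l | is_partn l) ratr (a l) * x%:R ^+ size (parts l) : algC).
  rewrite rmorph_sum; apply: eq_bigr => l _.
  by rewrite rmorphM rmorphXn /= ratr_nat.
transitivity (\sum_(S | internal_forest g w S) (-1) ^+ #|S| * mono_sum z S).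
  rewrite H raddf_sum; apply: eq_bigr => l _.
  rewrite /= mmapZ mmap_chrom chrom_at_path ?parts_neq0 //; congr (_ * _).
  rewrite (eq_big_seq (fun=> x%:R)) => [|m].
    by rewrite big_const_seq count_predT iter_mulr_1.
  rewrite mem_filter => /andP[m0 /mapP[i _ Ei]].
  by apply: (path_chrom_const Hz); rewrite lt0n m0 Ei -ltnS ltn_ord.
rewrite rmorphM rmorphXn rmorphN1 rmorph_sum mulr_sumr; apply: eq_bigr => S IS.
have /andP[SF _] := IS.
rewrite (mono_sum_forest gs gi Hz SF) -(card_proper_on gs gi _ _ SF).
rewrite sumr_const rmorphMn rmorphXn rmorphN1 -[X in _ = _ * X]mulr_natr mulrA; congr (_ * _).
(* The number of vertices is the number of edges plus that of components, so the component sign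
   cancels and leaves the sign of the edge count. *)
by rewrite -(card_spanning_forest gs gi SF) exprD -mulrA -expr2 sqrr_sign mulr1.
Qed.
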